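(* Let $H$ be a Halin graph. Then $AT(H)=4$ if $H$ is a wheel of even order, and $AT(H)=3$ otherwise.
   Context: All graphs are finite and simple. A Halin graph $H=T\cup C_n$ is a plane graph obtained from a plane tree $T$ having no vertex of degree two and at least one vertex of degree at least three, by adding a cycle $C_n$ that connects all the leaves (pendant vertices) of $T$ in the cyclic order determined by the planar drawing of $T$. The vertices of $C_n$ are called outer vertices and the others inner vertices. A wheel is a Halin graph with exactly one inner vertex; its order is its total number of vertices. For a digraph $D$, an Eulerian subdigraph is a spanning subdigraph (i.e. a subset of the arcs, possibly empty, on all vertices) in which every vertex has indegree equal to outdegree; it is even or odd according to the parity of its number of arcs. The Alon–Tarsi number $AT(G)$ of a graph $G$ is the smallest integer $k$ such that $G$ has an orientation $D$ with maximum outdegree at most $k-1$ for which the number of even Eulerian subdigraphs of $D$ differs from the number of odd Eulerian subdigraphs of $D$. *)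

(* Defs.v *)
From mathcomp Require Import all_boot.
Set Implicit Arguments. Unset Strict Implicit. Unset Printing Implicit Defensive.

Section Graphs.
Variable V : finType.

Definition is_orientation (adj : rel V) (D : {set V * V}) : Prop :=
  (forall u v, (u, v) \in D -> adj u v) /\
  (forall u v, adj u v -> ((u, v) \in D) (+) ((v, u) \in D)).

Definition outdeg (D : {set V * V}) (v : V) : nat := #|[set a in D | a.1 == v]|.
Definition indeg (D : {set V * V}) (v : V) : nat := #|[set a in D | a.2 == v]|.

Definition eulerian_sub (D S : {set V * V}) : bool :=
  (S \subset D) && [forall v, outdeg S v == indeg S v].

Definition n_even_eul (D : {set V * V}) : nat :=
  #|[set S : {set V * V} | eulerian_sub D S && ~~ odd #|S|]|.
Definition n_odd_eul (D : {set V * V}) : nat :=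
  #|[set S : {set V * V} | eulerian_sub D S && odd #|S|]|.

Definition AT_good (adj : rel V) (k : nat) : Prop :=
  exists D : {set V * V}, [/\ is_orientation adj D,
    (forall v, outdeg D v < k) & n_even_eul D <> n_odd_eul D].

Definition AT_number (adj : rel V) (k : nat) : Prop :=
  AT_good adj k /\ (forall j, j < k -> ~ AT_good adj j).

Definition deg (T : rel V) (v : V) : nat := #|[set u | T v u]|.
Definition leaf (T : rel V) (v : V) : bool := deg T v == 1.

Definition is_tree (T : rel V) : Prop :=
  [/\ symmetric T, irreflexive T, (forall u v, connect T u v) &
      #|[set p : V * V | T p.1 p.2]| = 2 * (#|V| - 1)].

(* rho is a rotation system (plane embedding) of T: for every vertex v,
   rho v is a cyclic permutation of the neighbourhood of v. *)
Definition rotation_system (T : rel V) (rho : V -> V -> V) : Prop :=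
  forall v u, T v u ->
    T v (rho v u) /\ (forall w, T v w -> exists k, iter k (rho v) u = w).

(* boundary (face-tracing) walk on darts (tail, head) *)
Definition face_step (rho : V -> V -> V) (d : V * V) : V * V :=
  (d.2, rho d.2 d.1).

(* l' is the leaf following the leaf l in the cyclic order of the leaves
   determined by the plane drawing of T *)
Definition next_leaf (T : rel V) (rho : V -> V -> V) (l l' : V) : Prop :=
  [/\ leaf T l, leaf T l' &
    exists p k, [/\ T p l, 0 < k, (iter k (face_step rho) (p, l)).2 = l' &
      forall j, 0 < j < k -> ~~ leaf T (iter j (face_step rho) (p, l)).2]].

Definition halin_structure (adj : rel V) (T : rel V) (rho : V -> V -> V) : Prop :=
  [/\ is_tree T, rotation_system T rho,
      (forall v, deg T v <> 2), (exists v, 3 <= deg T v) &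
      (forall u v, adj u v <-> (T u v \/ next_leaf T rho u v \/ next_leaf T rho v u))].

Definition inner_vertices (T : rel V) : {set V} := [set v | ~~ leaf T v].
Definition is_wheel (T : rel V) : bool := #|inner_vertices T| == 1.

End Graphs.

(* Main.v *)
(* The edge count gives AT(H) >= 3, and a wheel of even order is not 3-colourable while
   an orientation with outdegrees below k and E <> O yields a k-colouring.

   Upper bounds. Orient the tree edges towards a root and the rim along the cyclic order
   of the leaves. If the number of leaves is even, take an inner root: the only Eulerian
   subdigraphs are the empty one and the rim, both even. Reversing one rim arc makes the
   digraph acyclic, whence AT(H) <= 4.
   If the number of leaves is odd and H is not a wheel, some tree edge vw joins two inner
   vertices and one of its sides, say the side R of w, has an odd number t of leaves. Take
   as root the first leaf of R on the rim, and reverse vw and the rim arc entering R: then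
   every edge between R and its complement leaves R, the complement is acyclic, and the
   Eulerian subdigraphs correspond to the t leaves of R (follow the rim from the root to
   that leaf, then return through the tree). As t is odd, E <> O.

   That the leaves of R are consecutive, and that the rim is one cycle, follows from the
   fact that a plane tree has a single face. *)
Require Import Defs.
From mathcomp Require Import all_boot all_algebra all_field zify.
Set Implicit Arguments. Unset Strict Implicit. Unset Printing Implicit Defensive.

(** * Eulerian subdigraphs and colourings *)

Section EulerianSubdigraphs.
Variable V : finType.
Implicit Types (D S : {set V * V}) (adj : rel V).

Lemma sum_tails S (f : V -> nat) :
  \sum_(a in S) f a.1 = \sum_v outdeg S v * f v.
Proof.
rewrite (partition_big (fun a : V * V => a.1) predT) //=.
apply: eq_bigr => v _; rewrite (eq_bigr (fun=> f v)); last by move=> a /andP[_ /eqP->].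
by rewrite sum_nat_const /outdeg cardsE; congr (_ * _); apply: eq_card => a; rewrite !inE.
Qed.

Lemma sum_heads S (f : V -> nat) :
  \sum_(a in S) f a.2 = \sum_v indeg S v * f v.
Proof.
rewrite (partition_big (fun a : V * V => a.2) predT) //=.
apply: eq_bigr => v _; rewrite (eq_bigr (fun=> f v)); last by move=> a /andP[_ /eqP->].
by rewrite sum_nat_const /indeg cardsE; congr (_ * _); apply: eq_card => a; rewrite !inE.
Qed.

Lemma sum_outdeg S : \sum_v outdeg S v = #|S|.
Proof.
rewrite -sum1_card (sum_tails S (fun=> 1)).
by apply: eq_bigr => v _; rewrite muln1.
Qed.

Lemma eulerian_subP D S :
  reflect (S \subset D /\ forall v, outdeg S v = indeg S v) (eulerian_sub D S).
Proof. by apply: (iffP andP) => -[sSD /'forall_eqP]. Qed.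

Lemma outdeg_sub S D v : S \subset D -> outdeg S v <= outdeg D v.
Proof. 
move=> sSD; apply/subset_leq_card/subsetP => a.
by rewrite !inE => /andP[/(subsetP sSD)-> ->]. Qed.

Lemma eulerian_sub0 D : eulerian_sub D set0.
Proof.
apply/eulerian_subP; split=> [|v]; first exact: sub0set.
by rewrite /outdeg /indeg; apply: eq_card => a; rewrite !inE.
Qed.

(** As indegrees and outdegrees agree, a potential [f] has the same total over the tails of [S] as
    over the heads, so it cannot drop on any arc. Acyclicity is shown below by exhibiting such
    potentials. *)
Lemma eulerian_sub_const D S (f : V -> nat) :
    eulerian_sub D S -> (forall a, a \in S -> f a.2 <= f a.1) ->
  forall a, a \in S -> f a.2 = f a.1.
Proof.
case/eulerian_subP => _ eqS le_f a aS.
have le_S b : b \in S -> f b.2 <= f b.1 ?= iff (f b.2 == f b.1).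
  by move=> bS; split; first exact: le_f.
have [_ /esym] := leqif_sum le_S.
rewrite sum_tails sum_heads; under eq_bigr do rewrite -eqS.
by rewrite eqxx => /forall_inP/(_ _ aS)/eqP.
Qed.

Lemma eulerian_sub_empty D S (f : V -> nat) :
    eulerian_sub D S -> (forall a, a \in S -> f a.2 < f a.1) -> S = set0.
Proof.
move=> eS lt_f; apply/setP => a; rewrite inE; apply/negP => aS.
have := eulerian_sub_const eS (fun b bS => ltnW (lt_f b bS)) aS.
by move/eqP; rewrite ltn_eqF ?lt_f.
Qed.

(** An injection of the finite set [C] into itself permutes it, so each vertex of [C] has exactly
    one arc out and one arc in. *)
Lemma eulerian_sub_inj_graph D (C : {set V}) (f : V -> V) :
    {in C, forall x, f x \in C} -> {in C &, injective f} ->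
    {in C, forall x, (x, f x) \in D} ->
  eulerian_sub D [set (x, f x) | x in C].
Proof.
move=> fC f_inj fD; apply/eulerian_subP; split=> [|v].
  by apply/subsetP => _ /imsetP[x xC ->]; apply: fD.
have fCC : f @: C = C.
  apply/eqP; rewrite eqEcard card_in_imset // leqnn andbT.
  by apply/subsetP => _ /imsetP[x xC ->]; apply: fC.
have [vC|vC] := boolP (v \in C); last first.
  rewrite /outdeg /indeg !(@eq_card0 _ (mem [set _ in _ | _])) // => a; rewrite !inE;
    apply/andP=> -[/imsetP[x xC ->]] /= /eqP xv; case/negP: vC; rewrite -xv //.
  exact: fC.
have [u uC v_fu] : exists2 u, u \in C & v = f u by apply/imsetP; rewrite fCC.
have -> : outdeg [set (x, f x) | x in C] v = 1.
  apply/eqP/cards1P; exists (v, f v); apply/setP => a; rewrite !inE.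
  apply/andP/eqP => [[/imsetP[x _ ->] /= /eqP->] //|-> /=].
  by split; first exact: imset_f.
apply/esym/eqP/cards1P; exists (u, f u); apply/setP => a; rewrite !inE.
apply/andP/eqP => [[/imsetP[x xC ->] /= /eqP]|->]; last first.
  by split; [exact: imset_f | rewrite /= v_fu].
by rewrite v_fu => /f_inj->.
Qed.

Lemma AT_goodW adj j k : j <= k -> AT_good adj j -> AT_good adj k.
Proof. by move=> lejk [D [oD dD nD]]; exists D; split=> // v; apply: leq_trans lejk. Qed.

(** * Colourings from orientations, by sums over roots of unity *)

Section Colouring.
Import GRing.Theory Num.Theory.
Local Open Scope ring_scope.

(** Orthogonality of characters: with [y = z^(i-j)] the sum is geometric and [y^k = 1]. *)
Lemma sum_prim_root_ratio (k i j : nat) (z : algC) : k.-primitive_root z ->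
  \sum_(c < k) (z ^+ c) ^+ i / (z ^+ c) ^+ j
    = if i == j %[mod k] then k%:R else 0.
Proof.
move=> zk; have z_neq0 : z != 0 by rewrite (prim_root_eq0 zk) -lt0n (prim_order_gt0 zk).
pose y := z ^+ i / z ^+ j.
have yE c : (z ^+ c) ^+ i / (z ^+ c) ^+ j = y ^+ c.
  by rewrite /y exprMn exprVn -!exprM !(mulnC c).
under eq_bigr do rewrite yE.
rewrite -(eq_prim_root_expr zk); have [eq_ij | neq_ij] := eqVneq.
  rewrite /y eq_ij divff ?expf_neq0 //.
  by under eq_bigr do rewrite expr1n; rewrite sumr_const card_ord.
have y_neq1 : y - 1 != 0.
  rewrite subr_eq0; apply: contraNneq neq_ij => y1.
  by rewrite -[_ ^+ i](divfK (expf_neq0 j z_neq0)) -/y y1 mul1r.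
apply: (mulfI y_neq1); rewrite mulr0 -subrX1 /y exprMn exprVn -!exprM !(mulnC _ k) !exprM.
by rewrite (prim_expr_order zk) !expr1n divr1 subrr.
Qed.

Lemma prod_arcs_ratio (k : nat) (z : algC) S (c : V -> 'I_k) :
  \prod_(a in S) (z ^+ c a.2 / z ^+ c a.1)
    = \prod_v ((z ^+ c v) ^+ indeg S v / (z ^+ c v) ^+ outdeg S v).
Proof.
rewrite !prodf_div !prodrXr (sum_tails _ c) (sum_heads _ c) -!prodrXr.
by congr (_ / _); apply: eq_bigr => v _; rewrite mulnC exprM.
Qed.

(** As outdegrees are below [k], the congruence makes [outdeg S v] the residue of [indeg S v], hence
    at most [indeg S v]; both sum to [#|S|], so equality holds everywhere. *)
Lemma eulerian_subPmod D S k : (0 < k)%N -> S \subset D ->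
    (forall v, (outdeg D v < k)%N) ->
  eulerian_sub D S = [forall v, indeg S v == outdeg S v %[mod k]].
Proof.
move=> k_gt0 sSD dD; apply/eulerian_subP/'forall_eqP => [[_ eqS] v|eqS].
  by rewrite eqS.
have le_oi v : (outdeg S v <= indeg S v)%N.
  have -> : outdeg S v = (indeg S v %% k)%N; last exact: leq_mod.
  by rewrite eqS modn_small // (leq_ltn_trans (outdeg_sub v sSD)).
split=> // v; have [_ /esym] := leqif_sum (fun u (_ : true) => leqif_eq (le_oi u)).
have -> : \sum_v indeg S v = \sum_v outdeg S v.
  rewrite sum_outdeg -sum1_card (sum_heads S (fun=> 1%N)).
  by apply: eq_bigr => u _; rewrite muln1.
by rewrite eqxx => /forallP/(_ v)/eqP.
Qed.

Lemma n_even_oddE D :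
  \sum_(S | eulerian_sub D S) (-1) ^+ #|S| = (n_even_eul D)%:R - (n_odd_eul D)%:R :> algC.
Proof.
rewrite (bigID (fun S : {set V * V} => odd #|S|)) /= addrC; congr (_ + _).
  rewrite (eq_bigr (fun=> 1)) => [|S /andP[_ /negbTE oS]]; last by rewrite -signr_odd oS.
  by rewrite sumr_const; congr (_ *+ _); apply: eq_card => S; rewrite !inE.
rewrite (eq_bigr (fun=> -1)) => [|S /andP[_ oS]]; last by rewrite -signr_odd oS.
by rewrite sumr_const mulNrn; congr (- (_ *+ _)); apply: eq_card => S; rewrite !inE.
Qed.

(* Summing the product of [1 - c(head)/c(tail)] over all maps [c] to the [k]-th
   roots of unity gives [k ^ #|V|] times the Alon-Tarsi difference: this replaces
   the Combinatorial Nullstellensatz. *)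
Lemma sum_colourings D k z : k.-primitive_root z -> (forall v, (outdeg D v < k)%N) ->
  \sum_(c : {ffun V -> 'I_k}) \prod_(a in D) (1 - z ^+ c a.2 / z ^+ c a.1)
    = k%:R ^+ #|V| * ((n_even_eul D)%:R - (n_odd_eul D)%:R) :> algC.
Proof.
move=> zk dD; have k_gt0 := prim_order_gt0 zk.
(* [F] vanishes outside [D], so expanding the product of [F c a + 1] over all sets of pairs leaves
   only the subsets of [D]. *)
pose F (c : {ffun V -> 'I_k}) a : algC := if a \in D then - (z ^+ c a.2 / z ^+ c a.1) else 0.
have expand (c : {ffun V -> 'I_k}) : \prod_(a in D) (1 - z ^+ c a.2 / z ^+ c a.1)
    = \sum_(S : {set V * V} | S \subset D) (-1) ^+ #|S| * \prod_(a in S) (z ^+ c a.2 / z ^+ c a.1).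
  transitivity (\prod_a (F c a + 1)).
    rewrite big_mkcond; apply: eq_bigr => a _; rewrite /F.
    by case: ifP; rewrite ?add0r // addrC.
  rewrite bigA_distr [RHS]big_mkcond; apply: eq_bigr => S _; rewrite -big_mkcond /=.
  case: ifP => [sSD | /negbT/subsetPn[a aS aD]]; last first.
    by rewrite (bigD1 a) //= /F (negbTE aD) mul0r.
  rewrite -prodrN; apply: eq_bigr => a aS.
  by rewrite /F (subsetP sSD).
rewrite (eq_bigr _ (fun c _ => expand c)) exchange_big /= -n_even_oddE mulr_sumr.
rewrite big_mkcond [RHS]big_mkcond; apply: eq_bigr => S _.
case: ifP => [sSD | sSD]; last first.
  by rewrite ifN //; apply: contraFN sSD => /eulerian_subP[].
rewrite -mulr_sumr (eulerian_subPmod k_gt0 sSD dD).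
under eq_bigr do rewrite prod_arcs_ratio.
(* The roots at different vertices are chosen independently, so the sum over [c] factors into one
   character sum per vertex. *)
rewrite -(bigA_distr_bigA (fun v (i : 'I_k) => (z ^+ i) ^+ indeg S v / (z ^+ i) ^+ outdeg S v)).
under eq_bigr do rewrite (sum_prim_root_ratio _ _ zk).
case: ifP => [/forallP eqS | /negbT].
  under eq_bigr do rewrite eqS.
  by rewrite prodr_const mulrC.
by rewrite negb_forall => /existsP[v /negbTE neqv]; rewrite (bigD1 v) //= neqv mul0r mulr0.
Qed.

(** If every [c] gives some arc two ends of the same colour, each product in [sum_colourings] has a
    factor [1 - 1] and the sum vanishes, against the inequality of the even and odd counts. *)
Lemma AT_good_colouring adj k : (0 < k)%N -> AT_good adj k ->
  exists c : V -> 'I_k, forall u v, adj u v -> c u != c v.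
Proof.
move=> k_gt0 [D [[D_adj adj_D] dD nD]]; have [z zk] := C_prim_root_exists k_gt0.
case: (pickP (fun c : {ffun V -> 'I_k} => [forall a in D, c a.1 != c a.2])) => [c /forall_inP cP | none].
  exists c => u v /adj_D.
  by case: (boolP (_ \in D)) => [/cP //|_ /= /cP]; rewrite eq_sym.
have := sum_colourings zk dD; rewrite big1 => [/esym/eqP|c _].
  rewrite mulf_eq0 expf_eq0 pnatr_eq0 (gtn_eqF k_gt0) andbF /= subr_eq0 eqr_nat.
  by move=> /eqP.
have /negbT/forall_inPn[a aD /negPn/eqP cE] := none c.
have z_neq0 : z != 0 by rewrite (prim_root_eq0 zk) -lt0n.
by rewrite (bigD1 a) //= cE divff ?expf_neq0 // subrr mul0r.
Qed.

End Colouring.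

End EulerianSubdigraphs.

(** * Trees *)

Section RootedTrees.
Variables (V : finType) (T : rel V).

Record rooted (r : V) (par : V -> V) (dep : V -> nat) : Prop := Rooted {
  par_root : par r = r;
  dep_root : dep r = 0;
  dep_par : forall x, x != r -> dep x = (dep (par x)).+1;
  adj_par : forall x y, T x y = (x != r) && (y == par x) || (y != r) && (x == par y) }.

Fixpoint reach (r : V) (n : nat) (x : V) : bool :=
  if n is n'.+1 then [exists y, reach r n' y && T y x] else x == r.

Lemma connect_reach r x : connect T r x -> exists n, reach r n x.
Proof.
case/connectP => p; elim/last_ind: p x => [|p y IHp] x /=; first by move=> _ ->; exists 0; apply/eqxx.
rewrite rcons_path last_rcons => /andP[/IHp IH Ty] ->.
by have [n rn] := IH _ erefl; exists n.+1; apply/existsP; exists (last r p); apply/andP.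
Qed.

(** [dep] is the distance from [r], and each other vertex picks a neighbour one level nearer. The
    pairs [(x, par x)] and their reversals are disjoint and number [2 * (#|V| - 1)], so by the count
    in [is_tree] there are no other edges. *)
Lemma tree_rooted (r : V) : is_tree T -> exists par dep, rooted r par dep.
Proof.
move=> [symT irrT connT cardT].
have ex_reach x : exists n, reach r n x by apply: connect_reach.
pose dep x := ex_minn (ex_reach x).
have depP x : reach r (dep x) x by rewrite /dep; case: ex_minnP.
have dep_min x n : reach r n x -> dep x <= n by rewrite /dep; case: ex_minnP => m _; apply.
have dep_r : dep r = 0 by apply/eqP; rewrite -leqn0 dep_min /=.
have ex_par x : x != r -> exists y, T x y && (dep x == (dep y).+1).
  move=> xr; have := depP x; case E: (dep x) => [|n] /=; first by rewrite (negbTE xr).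
  case/existsP => y /andP[ry Tyx]; exists y; rewrite symT Tyx eqSS eqn_leq (dep_min _ _ ry) andbT.
  by rewrite -ltnS -E dep_min //=; apply/existsP; exists y; rewrite depP.
(* At [r], of depth 0, no neighbour qualifies, so the default yields [par r = r]. *)
pose par x := odflt r [pick y | T x y && (dep x == (dep y).+1)].
have parP x : x != r -> T x (par x) /\ dep x = (dep (par x)).+1.
  move=> xr; rewrite /par; case: pickP => [y /andP[? /eqP]|no] //.
  by have [y] := ex_par x xr; rewrite no.
pose A := [set (x, par x) | x in [set~ r]]; pose B := [set (par x, x) | x in [set~ r]].
have AT a : a \in A -> T a.1 a.2.
  by case/imsetP => x; rewrite !inE => /parP[? _] ->.
have BT a : a \in B -> T a.1 a.2.
  by case/imsetP => x; rewrite !inE symT => /parP[? _] ->.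
have disAB : [disjoint A & B].
  rewrite -setI_eq0; apply/eqP/setP => a; rewrite !inE; apply/negbTE/andP.
  case=> /imsetP[x]; rewrite !inE => /parP[_ dx] -> /imsetP[y].
  by rewrite !inE => /parP[_ dy] [xE yE]; move: dx dy; rewrite yE -xE; lia.
have cA : #|A| = #|V| - 1 by rewrite card_imset ?cardsC1 ?subn1 // => x y [].
have cB : #|B| = #|V| - 1 by rewrite card_imset ?cardsC1 ?subn1 // => x y [].
have eqT : A :|: B = [set a | T a.1 a.2].
  apply/eqP; rewrite eqEcard cardT cardsU disjoint_setI0 // cards0 cA cB subn0 addnn -mul2n leqnn andbT.
  by apply/subsetP => a; rewrite !inE => /orP[/AT|/BT].
exists par, dep; split=> // [|x /parP[]//|x y].
  rewrite /par; case: pickP => // y /andP[_]; by rewrite dep_r.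
have -> : T x y = ((x, y) \in A :|: B) by rewrite eqT inE.
rewrite inE; congr (_ || _).
  apply/imsetP/andP => [[z]|[xr /eqP->]]; last by exists x; rewrite ?inE.
  by rewrite !inE => zr [-> ->].
apply/imsetP/andP => [[z]|[xr /eqP->]]; last by exists y; rewrite ?inE.
by rewrite !inE => zr [-> ->].
Qed.

Section Rooted.
Variables (r : V) (par : V -> V) (dep : V -> nat).
Hypothesis rT : rooted r par dep.

Lemma adj_parent x : x != r -> T x (par x).
Proof. by move=> xr; rewrite (adj_par rT) xr eqxx. Qed.

Lemma rooted_ind (P : V -> Prop) :
  P r -> (forall x, x != r -> P (par x) -> P x) -> forall x, P x.
Proof.
move=> Pr Pp x; have [n] := ubnP (dep x); elim: n x => // n IHn x.
have [-> //|xr] := eqVneq x r; rewrite (dep_par rT xr) => lt_n.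
exact/Pp/IHn.
Qed.

Lemma dep_par_iter x i : dep (iter i par x) = dep x - i.
Proof.
elim: i => [|i IHi]; first by rewrite subn0.
rewrite iterS; have [zr|zr] := eqVneq (iter i par x) r.
  by rewrite zr (par_root rT) (dep_root rT); move: IHi; rewrite zr (dep_root rT); lia.
by move: IHi; rewrite (dep_par rT zr); lia.
Qed.

(** The bound on [i] makes this boolean; [ancestorP] removes it, since iterating [par] further stays
    at the root. *)
Definition ancestor (x y : V) : bool := [exists i : 'I_(dep y).+1, x == iter i par y].

Lemma ancestorP x y : reflect (exists i, x = iter i par y) (ancestor x y).
Proof.
apply: (iffP existsP) => [[i /eqP->]|[i ->]]; first by exists i.
have [le|lt] := leqP i (dep y); first by exists (Ordinal (le : i < (dep y).+1)).
exists ord_max; rewrite -(subnK (ltnW lt)) iterD /=.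
suff -> : iter (dep y) par y = r by apply/eqP; elim: (i - _) => //= n ->; rewrite (par_root rT).
apply/eqP; apply: contraT => /(dep_par rT).
by rewrite dep_par_iter subnn.
Qed.

Lemma ancestorxx x : ancestor x x. Proof. by apply/ancestorP; exists 0. Qed.

Lemma ancestor_par x y : ancestor x y -> ancestor (par x) y.
Proof. by move=> /ancestorP[i ->]; apply/ancestorP; exists i.+1. Qed.

(** The ancestors of [y] form a chain whose depths drop by one until the root: different exponents
    give equal depths only at depth 0. *)
Lemma ancestor_dep_inj y : {in ancestor^~ y &, injective dep}.
Proof.
move=> _ _ /ancestorP[i ->] /ancestorP[j ->]; rewrite !dep_par_iter => eqd.
wlog le_ij : i j eqd / i <= j => [IH|].
  by case/orP: (leq_total i j) => le; [exact: IH|exact/esym/IH].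
have [->//|ltij] := eqVneq i j.
have zr : iter i par y = r.
  by apply/eqP; apply: contraT => /(dep_par rT); rewrite -iterS !dep_par_iter; lia.
rewrite -(subnK le_ij) iterD zr.
by elim: (j - i) => //= n <-; rewrite (par_root rT).
Qed.

End Rooted.

Hypothesis treeT : is_tree T.

Let symT : symmetric T. Proof. by case: treeT. Qed.
Let irrT : irreflexive T. Proof. by case: treeT. Qed.

(** With the tree rooted at [w], the complement of [R] is the subtree below [v], whose only edge to
    the rest joins [v] to its parent [w]. *)
Lemma tree_cut v w : T v w -> exists R : {set V},
  [/\ w \in R, v \notin R & forall x y, x \notin R -> y \in R -> T x y -> x = v /\ y = w].
Proof.
move=> Tvw; have [par [dep rT]] := tree_rooted w treeT.
have vw : v != w by apply: contraTneq Tvw => ->; rewrite irrT.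
have pv : par v = w.
  move: Tvw; rewrite (adj_par rT) eqxx /= orbF => /andP[_ /eqP//].
exists [set x | ~~ ancestor par dep v x]; split; rewrite ?in_set.
- apply/negP => /(ancestorP rT)[i vE]; case/negP: vw; rewrite vE.
  by apply/eqP; elim: i {vE} => //= i ->; rewrite (par_root rT).
- by apply/negPn/(ancestorxx rT).
move=> x y; rewrite !in_set => /negPn/(ancestorP rT)[i vE] /negP y_nd.
rewrite (adj_par rT) => /orP[|] /andP[zr /eqP E].
  case: i vE => [/= vE|i vE]; first by rewrite -vE E -vE pv.
  by case: y_nd; apply/(ancestorP rT); exists i; rewrite E vE iterSr.
by case: y_nd; apply/(ancestorP rT); exists i.+1; rewrite vE E iterSr.
Qed.

End RootedTrees.

(** * Faces of plane trees *)

(** The cycle filtered by [P] lists the visits of [f] to [P], so the successor of [x] in it is the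
    first return of [f] to [P]. *)
Lemma next_map_filter (A B : eqType) (f : A -> A) (P : pred A) (h : A -> B) s x k :
    fcycle f s -> uniq [seq h y | y <- s & P y] -> x \in s -> P x ->
    0 < k -> P (iter k f x) -> (forall j, 0 < j < k -> ~~ P (iter j f x)) ->
  next [seq h y | y <- s & P y] (h x) = h (iter k f x).
Proof.
move=> cs us xs Px k_gt0 Pk Pj; have [i s' Es'] := rot_to xs.
have -> : next [seq h y | y <- s & P y] (h x) = next [seq h y | y <- rot i s & P y] (h x).
  move: us; rewrite -{1 2}(cat_take_drop i s) /rot !filter_cat !map_cat => us.
  by rewrite -(next_rot (size [seq h y | y <- take i s & P y]) us) rot_size_cat.
move: cs; rewrite -(rot_cycle i) Es' /= Px /= => cs.
have := fpathE cs; rewrite size_rcons trajectSr -iterSr => /rcons_inj[Es x_iter].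
have skip n y : (forall j, j < n -> ~~ P (iter j f y)) -> [seq z <- traject f y n | P z] = [::].
  move=> nP; apply/eqP; rewrite -(negbK (_ == _)) -has_filter.
  by apply/hasPn => _ /trajectP[j lt_jn ->]; apply: nP.
have [le_ks|lt_sk] := leqP k (size s').
  case: k k_gt0 Pk Pj le_ks => // k _ Pk Pj le_ks.
  rewrite Es -(subnKC le_ks) addSnnS trajectD filter_cat skip => [|j lt_jk].
    by rewrite /= -iterSr Pk /= eqxx.
  by rewrite -iterSr Pj.
(* The walk passes all of [s'] without meeting [P]: the first return is [x] itself, after exactly
   one full turn. *)
have [<-|neq_k] := eqVneq (size s').+1 k; last first.
  by have /negP[] := Pj (size s').+1 ltac:(lia); rewrite iterS -x_iter.
rewrite iterS -x_iter Es skip /= ?eqxx // => j lt_js.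
by rewrite -iterSr; apply: Pj; lia.
Qed.

Section Faces.
Variables (V : finType) (T : rel V) (rho : V -> V -> V).
Hypotheses (treeT : is_tree T) (rotT : rotation_system T rho).

Let symT : symmetric T. Proof. by case: treeT. Qed.

Lemma leaf_adj_inj l x y : leaf T l -> T l x -> T l y -> x = y.
Proof.
by move=> /cards1P[z /setP lz] lx ly; move: (lz x) (lz y); rewrite !inE lx ly => /esym/eqP-> /esym/eqP->.
Qed.

Lemma leaf_adj l : leaf T l -> exists p, T l p.
Proof. by move=> /cards1P[z /setP/(_ z)]; rewrite !inE eqxx => lz; exists z. Qed.

Lemma rotation_inj v : {in [set u | T v u] &, injective (rho v)}.
Proof.
apply/imset_injP; suff -> : rho v @: [set u | T v u] = [set u | T v u] by [].
apply/setP => w; rewrite inE; apply/imsetP/idP => [[u]|vw].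
  by rewrite inE => /rotT[vu _] ->.
have [v_rho _] := rotT vw; have [_ /(_ w vw)[k <-]] := rotT v_rho.
exists (iter k (rho v) w); last by rewrite -iterS iterSr.
by rewrite inE; elim: k => //= k /rotT[].
Qed.

(** [face_step] extended by the identity to the pairs that are not edges, so that it permutes a
    finite type and its orbits are available. *)
Definition dart_perm (d : V * V) : V * V := if T d.1 d.2 then face_step rho d else d.

Lemma dart_perm_adj d : T (dart_perm d).1 (dart_perm d).2 = T d.1 d.2.
Proof.
rewrite /dart_perm; case: ifP => [|->//]; case: d => u v /= uv.
by apply: (rotT _).1; rewrite symT.
Qed.

Lemma dart_perm_inj : injective dart_perm.
Proof.
move=> d e E; have := dart_perm_adj d; rewrite E dart_perm_adj.
move: E; rewrite /dart_perm; case: d e => [u v] [x y] /= E Txy; rewrite Txy in E.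
case: ifP E => // uv [E]; rewrite -{}E in Txy *; move=> E; congr (_, _).
by apply: rotation_inj E; rewrite inE symT ?uv ?Txy.
Qed.

Lemma iter_dart_perm d k : T d.1 d.2 -> iter k dart_perm d = iter k (face_step rho) d.
Proof.
move=> dT; elim: k => //= k IHk; rewrite -IHk /dart_perm ifT //.
by elim: k {IHk} => //= k; rewrite dart_perm_adj.
Qed.

(* A face of a plane tree crosses every edge equally often in both directions, so the
   darts on it are closed under reversal, hence under rotation. *)
Lemma one_face d0 d : T d0.1 d0.2 -> T d.1 d.2 -> fconnect dart_perm d0 d.
Proof.
move=> T0; set O := fconnect dart_perm d0.
have OS e : O (dart_perm e) = O e by rewrite /O -(same_fconnect1_r dart_perm_inj).
have OT e : O e -> T e.1 e.2.
  by case/iter_findex/esym => -> ; elim: (findex _ _ _) => //= k; rewrite dart_perm_adj.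
have balance (f : V -> nat) : \sum_(e | O e) f e.2 = \sum_(e | O e) f e.1.
  rewrite [RHS](reindex_inj dart_perm_inj) /= (eq_bigl _ _ OS).
  by apply: eq_bigr => e /OT eT; rewrite /dart_perm eT.
have Orev u v : O (u, v) -> O (v, u).
  move=> Ouv; apply: contraT => nOvu.
  (* Were [(v, u)] missing, the indicator of the side [R] of [v] would never decrease along the face
     and would increase at [(u, v)], against [balance]. *)
  have [R [vR uR cutR]] := tree_cut treeT (OT _ Ouv : T u v).
  have le_R e : O e -> (e.1 \in R : nat) <= (e.2 \in R) ?= iff ((e.1 \in R : nat) == (e.2 \in R)).
    move=> Oe; split=> //; case: (boolP (e.1 \in R)) => // e1; case: (boolP (e.2 \in R)) => // e2.
    have Te := OT _ Oe; rewrite symT in Te; have [E2 E1] := cutR _ _ e2 e1 Te.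
    by case/negP: nOvu; rewrite -E1 -E2 -surjective_pairing.
  have [_ /esym] := leqif_sum le_R; rewrite (balance (fun x => x \in R : nat)) eqxx.
  by move=> /forall_inP/(_ _ Ouv); rewrite /= vR (negbTE uR).
have Orot u v w : O (u, v) -> T u w -> O (u, w).
  move=> Ouv Tuw; have [_ /(_ w Tuw)[k <-]] := rotT (OT _ Ouv).
  elim: k => // k /Orev Oku; have := Oku; rewrite -OS /dart_perm.
  by rewrite (OT _ Oku : T _ _).
case: d0 d @O T0 OS OT balance Orev Orot => a b [x y] O /= Tab _ OT _ Orev Orot Txy.
suff Oall z : forall w, T z w -> O (z, w) by exact: Oall.
have [_ _ /(_ a z)/connectP[p] + + _] := treeT.
elim/last_ind: p z => [|p z' IHp] z /=.
  by move=> _ -> w Taw; apply: (Orot a b w _ Taw); apply: connect0.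
rewrite rcons_path last_rcons => /andP[/IHp IH Tz] -> w.
by apply: Orot; apply: Orev; apply: IH Tz.
Qed.

(** The face walk from any dart covers all darts, and exactly one dart enters each leaf, so this
    lists the leaves once each, in the cyclic order of the drawing. *)
Definition leaf_seq (d : V * V) : seq V := [seq e.2 | e <- orbit dart_perm d & leaf T e.2].

Section LeafSeq.
Variable d : V * V.
Hypothesis dT : T d.1 d.2.

Lemma orbit_adj e : (e \in orbit dart_perm d) = T e.1 e.2.
Proof.
rewrite -fconnect_orbit; apply/idP/idP => [|/(one_face dT)//].
by case/iter_findex/esym => ->; elim: (findex _ _ _) => //= k; rewrite dart_perm_adj.
Qed.

Lemma leaf_seq_uniq : uniq (leaf_seq d).
Proof.
rewrite map_inj_in_uniq ?filter_uniq ?orbit_uniq // => -[u v] [x y].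
rewrite !mem_filter !orbit_adj /= => /andP[lv Tuv] /andP[_ Txy] vy.
by congr (_, _) => //; apply: (leaf_adj_inj lv); rewrite symT // vy.
Qed.

Lemma mem_leaf_seq x : (x \in leaf_seq d) = leaf T x.
Proof.
apply/mapP/idP => [[e]|lx]; first by rewrite mem_filter => /andP[? _] ->.
have [p xp] := leaf_adj lx; exists (p, x) => //.
by rewrite mem_filter lx orbit_adj /= symT.
Qed.

Lemma next_leafP u v : next_leaf T rho u v <-> leaf T u /\ v = next (leaf_seq d) u.
Proof.
have fc := cycle_orbit dart_perm_inj d.
have nextE p k : leaf T u -> T p u -> 0 < k -> leaf T (iter k (face_step rho) (p, u)).2 ->
    (forall j, 0 < j < k -> ~~ leaf T (iter j (face_step rho) (p, u)).2) ->
    (iter k (face_step rho) (p, u)).2 = next (leaf_seq d) u.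
  move=> lu pu k_gt0 lk lj; rewrite -(iter_dart_perm k (d := (p, u))) // in lk *.
  apply/esym/(@next_map_filter _ _ dart_perm (fun e => leaf T e.2) (fun e => e.2)
    (orbit dart_perm d) (p, u) k fc leaf_seq_uniq) => //; first by rewrite orbit_adj.
  by move=> j /lj; rewrite iter_dart_perm.
split=> [[lu lv [p [k [pu k_gt0 kE kP]]]]|[lu ->]].
  by split=> //; rewrite -kE; apply: nextE; rewrite ?kE.
split=> //; first by rewrite -mem_leaf_seq mem_next mem_leaf_seq.
have [p up] := leaf_adj lu; have pu : T p u by rewrite symT.
have ex_k : exists k, (0 < k) && leaf T (iter k (face_step rho) (p, u)).2.
  exists (order dart_perm (p, u)); rewrite order_gt0 -iter_dart_perm //.
  by rewrite (iter_order dart_perm_inj).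
case: (ex_minnP ex_k) => k /andP[k_gt0 lk] k_min; exists p, k.
have no_leaf j : 0 < j < k -> ~~ leaf T (iter j (face_step rho) (p, u)).2.
  by move=> /andP[j_gt0 lt_jk]; apply: contraL lt_jk => lj; rewrite -leqNgt k_min ?j_gt0.
by split=> //; apply: nextE.
Qed.

End LeafSeq.

(* The face leaves the side [R] of the edge [vw] only once, so the leaves on either
   side of an edge are consecutive. *)
Lemma leaf_seq_cut v w (R : {set V}) : T v w -> w \in R -> v \notin R ->
    (forall x y, x \notin R -> y \in R -> T x y -> x = v /\ y = w) ->
  exists LR LG, [/\ leaf_seq (v, w) = LR ++ LG,
    {in LR, forall x, x \in R} & {in LG, forall x, x \notin R}].
Proof.
move=> vw wR vR cutR; have wv : T w v by rewrite symT.
(* A stretch of the face containing neither dart of the edge [vw] stays on one side of the cut. *)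
have stay e p : path (frel dart_perm) e p -> (v, w) \notin p -> (w, v) \notin p ->
    {in p, forall e', T e'.1 e'.2} -> {in p, forall e', (e'.2 \in R) = (e.2 \in R)}.
  elim: p e => //= a p IHp e /andP[/eqP ea ap]; rewrite !inE !negb_or.
  move=> /andP[a_vw p_vw] /andP[a_wv p_wv] pT.
  have Ta : T a.1 a.2 by apply: pT; rewrite mem_head.
  have a1 : a.1 = e.2.
    have Te : T e.1 e.2 by rewrite -dart_perm_adj ea.
    by rewrite -ea /dart_perm Te.
  have aR : (a.2 \in R) = (e.2 \in R).
    rewrite -a1; apply/idP/idP => aR.
      apply: contraNT a_vw => a1R; have [<- <-] := cutR _ _ a1R aR Ta.
      by rewrite -surjective_pairing.
    apply: contraNT a_wv => a2R; rewrite symT in Ta; have [<- <-] := cutR _ _ a2R aR Ta.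
    by rewrite -surjective_pairing.
  move=> e'; rewrite inE => /predU1P[->//|e'p]; rewrite -aR; apply: IHp e'p => // e'' e''p.
  by apply: pT; rewrite inE e''p orbT.
have oT e : e \in orbit dart_perm (v, w) -> T e.1 e.2 by rewrite orbit_adj.
have wv_o : (w, v) \in orbit dart_perm (v, w) by rewrite orbit_adj.
have [p Ep] : exists p, orbit dart_perm (v, w) = (v, w) :: p.
  by rewrite /orbit -orderSpred; eexists.
have := orbit_uniq dart_perm (v, w); have := cycle_orbit dart_perm_inj (v, w).
rewrite /leaf_seq; rewrite {}Ep in oT wv_o *.
have {wv_o} : (w, v) \in p.
  by move: wv_o; rewrite inE => /predU1P[[wE _]|//]; move: vR; rewrite -wE wR.
move=> wvp; case/splitPr: wvp oT => p1 p2 oT cp up.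
exists [seq e.2 | e <- (v, w) :: p1 & leaf T e.2], [seq e.2 | e <- (w, v) :: p2 & leaf T e.2].
have [p1_in p2_out] : {in (v, w) :: p1, forall e, e.2 \in R} /\
    {in (w, v) :: p2, forall e, e.2 \notin R}.
  move: cp up; rewrite /= rcons_cat cat_path /= rcons_path => /and4P[path1 _ path2 _].
  rewrite mem_cat inE cat_uniq /= !negb_or => /andP[/and3P[vw_p1 _ vw_p2]].
  move=> /and3P[_ /andP[wv_p1 _] /andP[wv_p2 _]]; split=> e; rewrite inE => /predU1P[->//|e_p].
    rewrite (stay _ _ path1) //.
    by move=> e' e'p; apply: oT; rewrite inE mem_cat e'p orbT.
  rewrite (stay _ _ path2) //.
  by move=> e' e'p; apply: oT; rewrite !(inE, mem_cat) e'p !orbT.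
split=> [|x /mapP[e]|x /mapP[e]]; first by rewrite -map_cat -filter_cat.
  by rewrite mem_filter => /andP[_ /p1_in eR] ->.
by rewrite mem_filter => /andP[_ /p2_out eR] ->.
Qed.

(** Rooted at [w], a deepest vertex outside [R] is a leaf: a child outside [R] would be deeper, and
    a child in [R] would have to be the root [w]. *)
Lemma leaf_seq_cut_nonempty v w (R : {set V}) : T v w ->
    w \in R -> v \notin R ->
    (forall x y, x \notin R -> y \in R -> T x y -> x = v /\ y = w) ->
  exists2 x, leaf T x & x \notin R.
Proof.
move=> vw wR vR cutR; have [par [dep rT]] := tree_rooted w treeT.
case: (@arg_maxnP _ v [pred x | x \notin R] dep vR) => x /= xR x_max.
exists x => //; have xw : x != w by apply: contraNneq xR => ->.
apply/cards1P; exists (par x); apply/setP => y; rewrite !inE.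
apply/idP/eqP => [Txy|->]; last exact: (adj_parent rT).
move: (Txy); rewrite (adj_par rT) => /orP[/andP[_ /eqP//]|/andP[yw /eqP xE]].
have [yR|yR] := boolP (y \in R).
  by have [_ yE] := cutR _ _ xR yR Txy; rewrite yE eqxx in yw.
by have := x_max y yR; rewrite (dep_par rT yw) -xE /= ltnn.
Qed.

End Faces.

(** * Orientations of Halin graphs *)

Lemma index_next (A : eqType) (s : seq A) x : uniq s -> x \in s ->
  index (next s x) s = if (index x s).+1 == size s then 0 else (index x s).+1.
Proof.
case: s => // y s us xs; rewrite next_nth xs.
have : index x (y :: s) <= size s by rewrite -ltnS -[(size s).+1]/(size (y :: s)) index_mem.
move: (index x _) => i; rewrite eqSS leq_eqVlt.
case: eqVneq => [-> _ | _ lt_is]; first by rewrite nth_default // /= eqxx.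
by rewrite -[nth y s i]/(nth y (y :: s) i.+1) index_uniq.
Qed.

(** * Degrees, leaves and inner vertices of the tree *)

Section HalinTree.
Variables (V : finType) (T : rel V).
Hypotheses (treeT : is_tree T) (deg2 : forall v, deg T v <> 2) (deg3 : exists v, 3 <= deg T v).

Let symT : symmetric T. Proof. by case: treeT. Qed.

(** No edge would leave a pair of adjacent leaves, so by connectedness the tree would have no vertex
    of degree at least three. *)
Lemma leaf_not_adj u v : leaf T u -> leaf T v -> ~~ T u v.
Proof.
move=> lu lv; apply/negP => Tuv; have Tvu : T v u by rewrite symT.
have [par [dep rT]] := tree_rooted u treeT; have [z z3] := deg3.
suff /orP[/eqP zE|/eqP zE] : (z == u) || (z == v).
- by move: z3; rewrite zE (eqP lu).
- by move: z3; rewrite zE (eqP lv).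
elim/(rooted_ind rT): z {z3} => [|x xr]; first by rewrite eqxx.
have := adj_parent rT xr; rewrite symT => + /orP[] /eqP pE; rewrite pE => Tx.
  by rewrite (leaf_adj_inj lu Tx Tuv) eqxx orbT.
by rewrite (leaf_adj_inj lv Tx Tvu) eqxx.
Qed.

Lemma deg_gt0 v : 0 < deg T v.
Proof.
have [z z3] := deg3; have [par [dep rT]] := tree_rooted z treeT.
have [->|vz] := eqVneq v z; first exact: ltn_trans z3.
by apply/card_gt0P; exists (par v); rewrite inE (adj_parent rT).
Qed.

Lemma inner_deg v : ~~ leaf T v -> 3 <= deg T v.
Proof. by move: (deg_gt0 v) (@deg2 v); rewrite /leaf; lia. Qed.

Lemma sum_deg : \sum_v deg T v = 2 * (#|V| - 1).
Proof.
case: treeT => _ _ _ <-; rewrite -sum_outdeg; apply: eq_bigr => v _.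
rewrite /outdeg /deg -(card_imset [set u | T v u] (can_inj (fun u => erefl : (v, u).2 = u))).
apply: eq_card => -[x y]; rewrite !inE /=; apply/imsetP/andP => [[u]|[Txy /eqP vE]].
  by rewrite !inE => ? [-> ->].
by exists y; rewrite ?inE -?vE.
Qed.

(** The degrees sum to [2 * (#|V| - 1)]; each is 1 at a leaf and at least 3 at an inner vertex. *)
Lemma many_leaves : #|inner_vertices T| + 2 <= #|[set v | leaf T v]|.
Proof.
have V_gt0 : 0 < #|V| by have [z _] := deg3; apply/card_gt0P; exists z.
have : \sum_v (2 + ~~ leaf T v) <= \sum_v (deg T v + leaf T v).
  apply: leq_sum => v _; case: (boolP (leaf T v)) => [/eqP->//|/inner_deg]; lia.
have -> : #|inner_vertices T| = \sum_v ~~ leaf T v.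
  by rewrite -sum1_card big_mkcond; apply: eq_bigr => v _; rewrite inE; case: (leaf T v).
have -> : #|[set v | leaf T v]| = \sum_v leaf T v.
  by rewrite -sum1_card big_mkcond; apply: eq_bigr => v _; rewrite inE; case: (leaf T v).
rewrite !big_split /= sum_deg sum_nat_const -[#|xpredT|]/#|V|.
move: (\sum_v leaf T v) (\sum_v ~~ leaf T v) => n m; lia.
Qed.

Lemma inner_gt0 : 0 < #|inner_vertices T|.
Proof.
have [z z3] := deg3; apply/card_gt0P; exists z.
by rewrite inE /leaf; apply: contraTneq z3 => ->.
Qed.

(** With an inner root, the parent of another inner vertex is inner too, since a leaf other than the
    root has no child. *)
Lemma inner_edge : #|inner_vertices T| != 1 -> exists v w, [/\ T v w, ~~ leaf T v & ~~ leaf T w].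
Proof.
move=> m1; have /card_gt1P[a [b [aI bI ab]]] : 1 < #|inner_vertices T|.
  by move: m1 inner_gt0; case: #|_| => [|[]].
rewrite !inE in aI bI; have [par [dep rT]] := tree_rooted a treeT.
rewrite eq_sym in ab; exists b, (par b); split=> //; first exact: (adj_parent rT).
have [->//|pa] := eqVneq (par b) a; apply/negP => lp.
have /(leaf_adj_inj lp) bE : T (par b) b by rewrite symT (adj_parent rT).
have := dep_par rT ab; rewrite (dep_par rT pa) -(bE (par (par b)) (adj_parent rT pa)); lia.
Qed.

End HalinTree.

Lemma fconnect_next (A : finType) (s : seq A) x y : uniq s -> x \in s -> y \in s ->
  fconnect (next s) x y.
Proof. by move=> us xs ys; rewrite (fconnect_cycle (cycle_next us)). Qed.

Lemma outdeg_le_size (V : finType) (D : {set V * V}) v (s : seq V) :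
  (forall w, (v, w) \in D -> w \in s) -> outdeg D v <= size s.
Proof.
move=> Ds; rewrite /outdeg -(size_map (pair v)).
apply: leq_trans (card_size _); apply/subset_leq_card/subsetP => -[x w].
by rewrite !inE /= => /andP[xwD /eqP xv]; rewrite xv in xwD *; rewrite map_f ?Ds.
Qed.

Lemma AT_good_no_odd (V : finType) (adj : rel V) k (D : {set V * V}) :
    is_orientation adj D -> (forall v, outdeg D v < k) ->
    (forall S, eulerian_sub D S -> ~~ odd #|S|) ->
  AT_good adj k.
Proof.
move=> oD dD even; exists D; split=> //.
have -> : n_odd_eul D = 0.
  by apply: eq_card0 => S; rewrite !inE; apply/negP => /andP[/even/negbTE->].
by apply/eqP; rewrite -lt0n; apply/card_gt0P; exists set0; rewrite inE eulerian_sub0 cards0.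
Qed.

(** * Orientations built from a rooted tree and a cyclic list of leaves *)

Section HalinOrientation.
Variables (V : finType) (adj T : rel V) (L : seq V) (r : V) (par : V -> V) (dep : V -> nat).
Hypotheses (uL : uniq L) (L_leaf : forall x, (x \in L) = leaf T x) (L3 : 2 < size L).
Hypothesis leaf_nadj : forall u v, leaf T u -> leaf T v -> ~~ T u v.
Hypothesis rT : rooted T r par dep.
Hypothesis symT : symmetric T.
Hypothesis adjE : forall u v, adj u v <->
  (T u v \/ (leaf T u /\ v = next L u) \/ (leaf T v /\ u = next L v)).

Lemma dep_par_lt x : x != r -> dep (par x) < dep x.
Proof. by move=> xr; rewrite (dep_par rT xr). Qed.

Lemma leaf_par x y : leaf T y -> x != r -> par x = y -> y = r.
Proof.
move=> ly xr pE; apply/eqP; apply: contraT => yr.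
have Tyx : T y x by rewrite symT -pE (adj_parent rT).
have := leaf_adj_inj ly (adj_parent rT yr) Tyx => E.
by have := dep_par_lt yr; have := dep_par_lt xr; rewrite E pE; lia.
Qed.

Lemma mem_nextL x : x \in L -> next L x \in L.
Proof. by rewrite mem_next. Qed.

Lemma nextL_inj : {in L &, injective (next L)}.
Proof. by move=> x y _ _; apply: (can_inj (prev_next uL)). Qed.

Lemma next_next_neq x : x \in L -> next L (next L x) != x.
Proof.
move=> xL; apply/negP => /eqP /(congr1 (index^~ L)).
rewrite index_next ?mem_nextL // index_next //.
move: L3; have := index_mem x L; rewrite xL; move: (index x L) (size L) => i n.
by case: (i.+1 =P n) => [<-|_] /=; case: eqP; lia.
Qed.

Lemma next_neq x : x \in L -> next L x != x.
Proof. by move=> xL; apply: contraNneq (next_next_neq xL) => E; rewrite !E. Qed.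

Lemma next_nadj x : x \in L -> ~~ T x (next L x).
Proof. by move=> xL; apply: leaf_nadj; rewrite -L_leaf ?mem_nextL. Qed.

Lemma next_neq_par x : x \in L -> x != r -> next L x != par x.
Proof. by move=> xL xr; apply: contraTneq (adj_parent rT xr) => <-; apply: next_nadj. Qed.

Lemma next_par_neq x : x != r -> par x \in L -> next L (par x) != x.
Proof.
move=> xr pL; apply: contraTneq (adj_parent rT xr) => nE.
by rewrite symT -{2}nE next_nadj.
Qed.

(* [bt] and [bc] select the tree and rim edges that are reversed. *)
Definition halin_arcs (bt bc : pred V) : {set V * V} :=
  [set a | [|| [&& a.1 != r, a.2 == par a.1 & ~~ bt a.1],
               [&& a.2 != r, a.1 == par a.2 & bt a.2],
               [&& a.1 \in L, a.2 == next L a.1 & ~~ bc a.1] |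
               [&& a.2 \in L, a.1 == next L a.2 & bc a.2]]].

Variant halin_arc_spec (bt bc : pred V) : V -> V -> Prop :=
  | ArcUp x of x != r & ~~ bt x : halin_arc_spec bt bc x (par x)
  | ArcDown x of x != r & bt x : halin_arc_spec bt bc (par x) x
  | ArcNext x of x \in L & ~~ bc x : halin_arc_spec bt bc x (next L x)
  | ArcPrev x of x \in L & bc x : halin_arc_spec bt bc (next L x) x.

Lemma halin_arcsP bt bc u v : reflect (halin_arc_spec bt bc u v) ((u, v) \in halin_arcs bt bc).
Proof.
rewrite inE /=; apply: (iffP or4P) => [[] /and3P[? /eqP-> ?]|[] x xr bx]; try by constructor.
- by apply: Or41; rewrite xr eqxx bx.
- by apply: Or42; rewrite xr eqxx bx.
- by apply: Or43; rewrite xr eqxx bx.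
- by apply: Or44; rewrite xr eqxx bx.
Qed.

Lemma halin_arcs_orientation bt bc : is_orientation adj (halin_arcs bt bc).
Proof.
split=> [u v /halin_arcsP[] x xr _|u v].
- by apply/adjE; left; apply: adj_parent rT _ xr.
- by apply/adjE; left; rewrite symT; apply: adj_parent rT _ xr.
- by apply/adjE; right; left; rewrite -L_leaf.
- by apply/adjE; right; right; rewrite -L_leaf.
rewrite !inE /=.
(* The four ways in which [u] and [v] can be adjacent exclude each other; what then remains is a
   check over booleans. *)
have pp x y : [&& x != r & y == par x] -> [&& y != r & x == par y] = false.
  move=> /andP[xr /eqP->]; apply/negP => /andP[pr /eqP].
  by move=> xE; have := dep_par_lt pr; have := dep_par_lt xr; rewrite -xE; lia.
have nn x y : [&& x \in L & y == next L x] -> [&& y \in L & x == next L y] = false.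
  move=> /andP[xL /eqP->]; apply/negP => /andP[_]; rewrite eq_sym.
  exact/negP/next_next_neq.
have pn x y : [&& x != r & y == par x] -> [&& x \in L & y == next L x] = false.
  move=> /andP[xr /eqP->]; apply/negP => /andP[xL].
  by rewrite eq_sym; apply/negP/next_neq_par.
have np x y : [&& x != r & y == par x] -> [&& y \in L & x == next L y] = false.
  move=> /andP[xr /eqP->]; apply/negP => /andP[pL].
  by rewrite eq_sym; apply/negP/next_par_neq.
move: (pp u v) (pp v u) (nn u v) (nn v u) (pn u v) (pn v u) (np u v) (np v u).
have : adj u v -> [|| [&& u != r & v == par u], [&& v != r & u == par v],
    [&& u \in L & v == next L u] | [&& v \in L & u == next L v]].
  move=> /adjE[|[[lu ->]|[lv ->]]].
  - by rewrite (adj_par rT) => /orP[] ->; rewrite ?orbT.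
  - by rewrite (L_leaf u) eqxx lu /= !orbT.
  - by rewrite (L_leaf v) eqxx lv /= !orbT.
rewrite ![[&& _, _ & _]]andbA.
move: (_ && (v == par u)) (_ && (u == par v)) (_ && (v == next L u)) (_ && (u == next L v)).
move=> a b c d H1 H2 H3 H4 H5 H6 H7 H8 H9 /H1 {H1}.
by move: H2 H3 H4 H5 H6 H7 H8 H9; case: a b c d (bt u) (bt v) (bc u) (bc v) => -[] [] [] [] [] [] [];
  do ?[by [] | move=> /(_ isT) | move=> _].
Qed.

(** All outdegrees are at most one, so [D] has at most [#|V|] arcs, while the graph has [#|V| - 1]
    tree edges and at least three rim edges. *)
Lemma AT_lower j : is_tree T -> j < 3 -> ~ AT_good adj j.
Proof.
move=> [_ _ _ cardT] lt_j3 [D [[_ adjD] dD _]].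
have cD : #|D| <= #|V|.
  rewrite -sum_outdeg -sum1_card; apply: leq_sum => v _.
  by rewrite -ltnS (leq_trans (dD v)) // -ltnS.
pose N := [set (x, next L x) | x in [set y | y \in L]].
have cN : #|N| = size L.
  rewrite card_imset => [|x y [] //]; rewrite -(card_uniqP uL).
  by apply: eq_card => x; rewrite inE.
have disTN : [disjoint [set p | T p.1 p.2] & N].
  rewrite -setI_eq0; apply/eqP/setP => a; rewrite !inE; apply/negP => /andP[Ta /imsetP[x]].
  by rewrite inE => xL aE; move: Ta; rewrite aE; apply/negP/next_nadj.
have : [set p | T p.1 p.2] :|: N \subset D :|: [set (a.2, a.1) | a in D].
  apply/subsetP => -[x y] xyTN; have /adjD : adj x y.
    apply/adjE; move: xyTN; rewrite !inE => /orP[|/imsetP[z]]; first by left.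
    by rewrite inE L_leaf => lz [-> ->]; right; left.
  rewrite inE; case: (boolP (_ \in D)) => //= _ yxD.
  by apply/imsetP; exists (y, x).
move/subset_leq_card; rewrite cardsU disjoint_setI0 // cards0 subn0 cardT cN.
move/leq_trans/(_ (leq_card_setU _ _)); rewrite card_imset => [|[? ?] [? ?] [-> ->] //].
by move: cD L3; rewrite -[#|V|]/(#|V|); move: #|D| #|V| (size L); lia.
Qed.

Lemma leaves_gt0 : 0 < size L. Proof. exact: ltn_trans L3. Qed.

Lemma last_lt_size : (size L).-1 < size L. Proof. by rewrite prednK ?leaves_gt0. Qed.

Definition last_leaf := nth r L (size L).-1.

Lemma last_leafP x : x \in L -> (x == last_leaf) = ((index x L).+1 == size L).
Proof.
move=> xL; rewrite /last_leaf; apply/eqP/eqP => [->|nE].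
  by rewrite index_uniq ?prednK // ?last_lt_size ?leaves_gt0.
by rewrite -nE /= nth_index.
Qed.

Lemma index_nextL x : x \in L -> x != last_leaf -> index (next L x) L = (index x L).+1.
Proof. by move=> xL; rewrite last_leafP // index_next // => /negbTE->. Qed.

Lemma mem_last_leaf : last_leaf \in L. Proof. by rewrite mem_nth ?last_lt_size. Qed.

Lemma index_next_last : index (next L last_leaf) L = 0.
Proof.
by rewrite index_next ?mem_last_leaf // -last_leafP ?mem_last_leaf // eqxx.
Qed.

Lemma par_inner x : ~~ leaf T r -> x != r -> par x \notin L.
Proof. by move=> lr xr; rewrite L_leaf; apply: contraNN lr => lp; rewrite -(leaf_par lp xr). Qed.

Lemma AT_good4 : ~~ leaf T r -> AT_good adj 4.
Proof.
move=> lr; apply: (AT_good_no_odd (halin_arcs_orientation pred0 (pred1 last_leaf))) => [v|S eS].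
  apply: (@leq_ltn_trans (size [:: par v; next L v; last_leaf])) => //.
  apply: outdeg_le_size => w /halin_arcsP[] x //= xr; rewrite !inE ?eqxx ?orbT //.
  by move=> ->; rewrite !orbT.
(* A potential decreasing along every arc: leaves lie above all other vertices and decrease along
   the rim, inner vertices are ranked by depth. *)
pose f x := if x \in L then (\max_y dep y).+1 + (size L - index x L) else dep x.
rewrite (eulerian_sub_empty (f := f) eS) ?cards0 // => -[u v].
move/(subsetP (proj1 (elimT (eulerian_subP _ _) eS))); rewrite {eS} /f => /halin_arcsP[] x //= xr.
- move=> _; rewrite (negbTE (par_inner lr xr)); case: ifP => _; last exact: dep_par_lt.
  by rewrite addSn ltnS (leq_trans _ (leq_addr _ _)) // leq_bigmax.
- move=> x_last; rewrite xr mem_nextL // index_nextL //.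
  by rewrite ltn_add2l ltn_sub2l // index_mem.
move=> /eqP->; rewrite mem_nextL mem_last_leaf // index_next_last.
rewrite ltn_add2l ltn_sub2l ?leaves_gt0 // index_uniq ?last_lt_size //.
by rewrite -ltnS prednK ?leaves_gt0 // ltnW.
Qed.

Lemma AT_good3_even : ~~ leaf T r -> ~~ odd (size L) -> AT_good adj 3.
Proof.
move=> lr nL; apply: (AT_good_no_odd (halin_arcs_orientation pred0 pred0)) => [v|S eS].
  apply: (@leq_ltn_trans (size [:: par v; next L v])) => //.
  by apply: outdeg_le_size => w /halin_arcsP[] x //= xr; rewrite !inE ?eqxx ?orbT.
(* Constant on the rim and strictly decreasing along every tree arc, so [S] contains no tree arc. *)
pose f x := if x \in L then (\max_y dep y).+1 else dep x.
have SD : S \subset halin_arcs pred0 pred0 by case/eulerian_subP: eS.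
have le_f a : a \in S -> f a.2 <= f a.1.
  case: a => u v /(subsetP SD)/halin_arcsP[] x //= xr _; rewrite /f.
    rewrite (negbTE (par_inner lr xr)); case: ifP => _; last exact/ltnW/dep_par_lt.
    by rewrite ltnW // ltnS leq_bigmax.
  by rewrite xr mem_nextL.
have Snext u v : (u, v) \in S -> u \in L /\ v = next L u.
  move=> uvS; have := eulerian_sub_const eS le_f uvS; move: uvS.
  move=> /(subsetP SD)/halin_arcsP[] x //= xr _; rewrite /f.
  rewrite (negbTE (par_inner lr xr)); case: ifP => _ fE.
    by have := leq_bigmax (F := dep) (par x); rewrite fE ltnn.
  by have := dep_par_lt xr; rewrite fE ltnn.
have [->|[[u v] uvS]] := set_0Vmem S; first by rewrite cards0.
have [uL' vE] := Snext _ _ uvS.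
(* One rim arc in [S] forces the next, since its head needs an arc out, and so all of them. *)
have Sall x : x \in L -> (x, next L x) \in S.
  move=> xL; have := fconnect_next uL uL' xL => /iter_findex <-.
  elim: (findex _ _ _) => [|k IHk]; first by rewrite -vE.
  have : 0 < indeg S (iter k.+1 (next L) u).
    by apply/card_gt0P; exists (iter k (next L) u, iter k.+1 (next L) u); rewrite inE IHk /=.
  case/eulerian_subP: eS => _ <- /card_gt0P[[y z]]; rewrite inE /= => /andP[yzS /eqP yE].
  by have [_ zE] := Snext _ _ yzS; rewrite zE yE in yzS.
suff -> : S = [set (x, next L x) | x in [set y | y \in L]].
  rewrite card_imset => [|x y [] //]; rewrite (_ : #|_| = size L) // -(card_uniqP uL).
  by apply: eq_card => x; rewrite inE.
apply/setP => -[x y]; apply/idP/imsetP => [/Snext[xL ->]|[z]].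
  by exists x; rewrite ?inE.
by rewrite inE => /Sall zS [-> ->].
Qed.

(** * A cut whose side [R] holds the first [t] leaves, with the first of them as root *)

Section OddCase.
Variables (v w : V) (R : {set V}) (t : nat).
Hypotheses (lw : ~~ leaf T w) (wR : w \in R) (vR : v \notin R).
Hypothesis cutR : forall x y, x \notin R -> y \in R -> T x y -> x = v /\ y = w.
Hypotheses (rL : r \in L) (index_r : index r L = 0).
Hypotheses (R_index : forall x, x \in L -> (x \in R) = (index x L < t)).
Hypotheses (t_gt0 : 0 < t) (lt_tL : t < size L).

(** The reversed edges become the arcs from [w = par v] to [v] and from [r] to [last_leaf], so every
    arc between [R] and its complement leaves [R]. *)
Let D := halin_arcs (pred1 v) (pred1 last_leaf).

Lemma root_in_cut : r \in R. Proof. by rewrite R_index // index_r. Qed.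

Lemma par_cut : par v = w.
Proof.
suff: forall x, x \notin R -> par v = w by move/(_ v vR).
elim/(rooted_ind rT) => [|x xr IHx xR]; first by rewrite root_in_cut.
have [pR|/IHx//] := boolP (par x \in R).
by have [<- <-] := cutR xR pR (adj_parent rT xr).
Qed.

Lemma cut_neq_root : v != r. Proof. by apply: contraNneq vR => ->; apply: root_in_cut. Qed.

Lemma par_in_cut x : x != r -> x != v -> (par x \in R) = (x \in R).
Proof.
move=> xr xv; have Tx := adj_parent rT xr; apply/idP/idP => xR.
  by apply: contraNT xv => nxR; have [->] := cutR nxR xR Tx.
(* Here [x] would be [w] with parent [v], while [par_cut] makes [w] the parent of [v]: the depths
   contradict each other. *)
apply: contraT => npR; have [pE xE] := cutR npR xR (etrans (symT _ _) Tx).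
have := dep_par_lt xr; rewrite pE; have := dep_par_lt cut_neq_root; rewrite par_cut xE.
by move=> /ltnW; rewrite leqNgt => /negbTE->.
Qed.

Lemma leaf_par_root x : x != r -> par x \in L -> par x = r.
Proof. by move=> xr; rewrite L_leaf => lp; apply: leaf_par xr _. Qed.

Lemma last_notin_cut : last_leaf \notin R.
Proof.
rewrite R_index ?mem_last_leaf // /last_leaf index_uniq ?last_lt_size //.
by rewrite -leqNgt -ltnS prednK ?leaves_gt0.
Qed.

Lemma outdeg_odd x : outdeg D x < 3.
Proof.
(* The root is a leaf without parent arc and gains [last_leaf]; among the inner vertices only [w]
   gains an arc, to [v]. *)
pose s x := if x \in L then if x == r then [:: next L x; last_leaf]
  else [:: par x; next L x] else [:: par x; v].
apply: (@leq_ltn_trans (size (s x))); last by rewrite /s; do !case: ifP.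
apply: outdeg_le_size => y /halin_arcsP[] z /= zr => [_|/eqP zE|_|/eqP zE].
- by rewrite /s (negbTE zr); case: ifP; rewrite mem_head.
- by rewrite /s zE par_cut L_leaf (negbTE lw) !inE eqxx orbT.
- by rewrite /s zr; case: ifP; rewrite !inE eqxx ?orbT.
rewrite /s mem_nextL //; have -> : next L z == r.
  by rewrite -(nth_index r (mem_nextL zr)) zE index_next_last -index_r nth_index.
by rewrite zE !inE eqxx orbT.
Qed.

Section Eulerian.
Variable S : {set V * V}.
Hypothesis eS : eulerian_sub D S.

(** The indicator of [R] never increases along an arc of [D]. *)
Lemma eulerian_odd_cut a : a \in S -> (a.2 \in R) = (a.1 \in R).
Proof.
have SD : S \subset D by case/eulerian_subP: eS.
move=> aS; suff : (a.2 \in R : nat) = (a.1 \in R) by case: (a.1 \in R); case: (a.2 \in R).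
apply: (eulerian_sub_const (f := fun x => x \in R : nat) eS _ aS) => -[x y] /(subsetP SD)/halin_arcsP[] z /= zr => [zv|/eqP zE|zl|/eqP zE].
- by rewrite par_in_cut.
- by rewrite zE (negbTE vR).
- rewrite !R_index ?mem_nextL // index_nextL //.
  by case: (ltnP (_.+1) t) => // /ltnW->.
by rewrite zE (negbTE last_notin_cut).
Qed.

(** Outside [R] the potential of [AT_good4], set to 0 on [R], strictly decreases along every arc of
    [S]. *)
Lemma eulerian_odd_in a : a \in S -> a.1 \in R.
Proof.
have SD : S \subset D by case/eulerian_subP: eS.
pose f x := if x \in R then 0 else
  if x \in L then (\max_y dep y).+1 + (size L - index x L) else dep x.
have lt_f b : b \in S -> b.1 \notin R -> f b.2 < f b.1.
  case: b => x y xyS /= /negbTE xR; have := eulerian_odd_cut xyS; rewrite /f /= xR => yR.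
  rewrite yR; move: {xyS}(subsetP SD _ xyS) xR yR => /halin_arcsP[] z /= zr bz zR nzR.
  - have -> : (par z \in L) = false.
      by apply: contraFF nzR => /(leaf_par_root zr)->; apply: root_in_cut.
    case: ifP => _; last exact: dep_par_lt.
    by rewrite addSn ltnS (leq_trans _ (leq_addr _ _)) // leq_bigmax.
  - by move: zR; rewrite (eqP bz) par_cut wR.
  - by rewrite zr mem_nextL // index_nextL // ltn_add2l ltn_sub2l // index_mem.
  by move: zR; rewrite (eqP bz) R_index ?mem_nextL ?mem_last_leaf // index_next_last t_gt0.
have le_f b : b \in S -> f b.2 <= f b.1.
  move=> bS; have [bR|/(lt_f b bS)/ltnW//] := boolP (b.1 \in R).
  by rewrite /f eulerian_odd_cut // bR.
move=> aS; apply: contraT => /(lt_f a aS).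
by rewrite (eulerian_sub_const eS le_f aS) ltnn.
Qed.

Variant eulerian_odd_spec : V -> V -> Prop :=
  | EulerianUp x of x != r & x \in R : eulerian_odd_spec x (par x)
  | EulerianNext x of x \in L & (index x L).+1 < t : eulerian_odd_spec x (next L x).

Lemma eulerian_oddP x y : (x, y) \in S -> eulerian_odd_spec x y.
Proof.
move=> xyS; have xR := eulerian_odd_in xyS; have := eulerian_odd_cut xyS; rewrite /= xR.
have SD : S \subset D by case/eulerian_subP: eS.
move: xyS xR => /(subsetP SD)/halin_arcsP[] z /= zr bz zR nzR.
- exact: EulerianUp.
- by move: nzR; rewrite (eqP bz) (negbTE vR).
- by apply: EulerianNext => //; move: nzR; rewrite R_index ?mem_nextL // index_nextL.
by move: nzR; rewrite (eqP bz) (negbTE last_notin_cut).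
Qed.

Lemma eulerian_in_out x y : (x, y) \in S -> exists z, (y, z) \in S.
Proof.
move=> xyS; have : 0 < indeg S y by apply/card_gt0P; exists (x, y); rewrite inE xyS /=.
case/eulerian_subP: eS => _ <- /card_gt0P[[y' z]]; rewrite inE /= => /andP[yzS /eqP yE].
by exists z; rewrite -yE.
Qed.

Lemma eulerian_out_in x y : (x, y) \in S -> exists z, (z, x) \in S.
Proof.
move=> xyS; have : 0 < outdeg S x by apply/card_gt0P; exists (x, y); rewrite inE xyS /=.
case/eulerian_subP: eS => _ -> /card_gt0P[[z x']]; rewrite inE /= => /andP[yzS /eqP yE].
by exists z; rewrite -yE.
Qed.

Lemma eulerian_leaf_in x y : y \in L -> y != r -> (x, y) \in S -> y = next L x /\ x \in L.
Proof.
move=> yL yr /eulerian_oddP xyS; case: xyS yL yr => z zr _ pL pr; last by [].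
by rewrite (leaf_par_root zr pL) eqxx in pr.
Qed.

(** A leaf other than the root is entered only along the rim, so its indegree in [S], hence its
    outdegree, is at most one. *)
Lemma eulerian_leaf_up x : x \in L -> (x, par x) \in S -> x != r -> (x, next L x) \notin S.
Proof.
move=> xL xp xr; apply/negP => xn.
have : 1 < outdeg S x.
  have <- : #|[set (x, par x); (x, next L x)]| = 2.
    by rewrite cards2 xpair_eqE eqxx /= eq_sym (next_neq_par xL xr).
  apply/subset_leq_card/subsetP => a; rewrite !inE.
  by case/orP=> /eqP->; rewrite ?xp ?xn /=.
case/eulerian_subP: eS => _ -> ; rewrite ltnNge => /negP[].
rewrite -(cards1 (prev L x, x)); apply/subset_leq_card/subsetP => -[z y].
rewrite !inE /= => /andP[+ /eqP yE]; rewrite yE => /(eulerian_leaf_in xL xr)[-> _].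
by rewrite prev_next.
Qed.

End Eulerian.
(** Successor on the directed cycle that follows the rim from the root to the leaf of index [i] and
    returns through the tree. *)
Definition succ_cycle i x := if (x \in L) && (index x L < i) then next L x else par x.

Definition cycle_verts i : {set V} :=
  [set x | (x \in L) && (index x L < i)] :|: [set x | (x != r) && ancestor par dep x (nth r L i)].

(** For [i = 0] this is empty, as the leaf of index 0 is the root: the empty subdigraph is one of
    the [t] sets counted. *)
Definition leaf_cycle i : {set V * V} := [set (x, succ_cycle i x) | x in cycle_verts i].

Lemma cycle_vertsP i x : reflect
  ((x \in L /\ index x L < i) \/ (x != r /\ ancestor par dep x (nth r L i)))
  (x \in cycle_verts i).
Proof.
rewrite in_setU !in_set; apply: (iffP orP) => -[].
- by case/andP; left.
- by case/andP; right.
- by case=> -> ->; left.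
- by case=> -> ->; right.
Qed.

Lemma index_nth_leaf i : i < t -> index (nth r L i) L = i.
Proof. by move=> lt_it; rewrite index_uniq ?(ltn_trans lt_it). Qed.

Lemma mem_nth_leaf i : i < t -> nth r L i \in L.
Proof. by move=> lt_it; rewrite mem_nth ?(ltn_trans lt_it). Qed.

Lemma index_neq_last x : x \in L -> index x L < t -> x != last_leaf.
Proof. by move=> xL lt_xt; apply: contraNneq last_notin_cut => <-; rewrite R_index. Qed.

Lemma leaf_neq_root x : x \in L -> 0 < index x L -> x != r.
Proof. by move=> _; apply: contraTneq => ->; rewrite index_r. Qed.

Lemma ancestor_root x : ancestor par dep x r -> x = r.
Proof.
by case/(ancestorP rT) => k ->; elim: k => //= k ->; rewrite (par_root rT).
Qed.

Lemma ancestor_cut x y : y \in R -> ancestor par dep x y -> x \in R.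
Proof.
move=> yR /(ancestorP rT)[k ->]; elim: k => //= k IHk.
have [->|zr] := eqVneq (iter k par y) r; first by rewrite (par_root rT) root_in_cut.
by rewrite par_in_cut //; apply: contraNneq vR => <-.
Qed.

Lemma eulerian_leaf_cycle i : i < t -> eulerian_sub D (leaf_cycle i).
Proof.
move=> lt_it; apply: eulerian_sub_inj_graph => [x|x y|x].
- move/cycle_vertsP => xC; apply/cycle_vertsP; rewrite /succ_cycle.
  case: ifP => [/andP[xL lt_xi]|nx].
    have xn : index (next L x) L = (index x L).+1.
      by rewrite index_nextL // index_neq_last // (ltn_trans lt_xi).
    have [lt_ni|le_in] := ltnP (index (next L x) L) i; first by left; rewrite mem_nextL.
    right; rewrite leaf_neq_root ?mem_nextL ?xn //.
    have -> : i = index (next L x) L by apply/eqP; rewrite eqn_leq le_in xn lt_xi.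
    by rewrite nth_index ?mem_nextL // (ancestorxx rT).
  case: xC nx => [[-> ->]//|[xr anc_x] _].
  have [pr|pr] := eqVneq (par x) r; last by right; rewrite (ancestor_par rT).
  left; rewrite pr rL index_r; split=> //; rewrite lt0n; apply: contraNneq xr => i0.
  by move: anc_x; rewrite i0 -{1}index_r nth_index // => /ancestor_root->.
- move=> /cycle_vertsP xC /cycle_vertsP yC; rewrite /succ_cycle.
  (* A parent that is a leaf is the root, of index 0, whereas the rim part of the cycle only reaches
     leaves of positive index. *)
  have cross x' y' : (x' \in L) && (index x' L < i) -> y' != r -> next L x' <> par y'.
    move=> /andP[x'L lt_x'i] y'r nE.
    have := leaf_par_root y'r; rewrite -nE mem_nextL // => /(_ isT)/(congr1 (index^~ L)).
    by rewrite index_r index_nextL // index_neq_last // (ltn_trans lt_x'i).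
  case: ifP => [x1|nx]; case: ifP => [y1|ny].
  + by apply: nextL_inj; [case/andP: x1|case/andP: y1].
  + by case: yC ny => [[-> ->]//|[yr _] _] /(cross _ _ x1 yr).
  + by case: xC nx => [[-> ->]//|[xr _] _] /esym/(cross _ _ y1 xr).
  case: xC nx => [[-> ->]//|[xr anc_x] _]; case: yC ny => [[-> ->]//|[yr anc_y] _] pE.
  by apply: (ancestor_dep_inj rT anc_x anc_y); rewrite (dep_par rT xr) (dep_par rT yr) pE.
move/cycle_vertsP => xC; apply/halin_arcsP; rewrite /succ_cycle.
case: ifP => [/andP[xL lt_xi]|nx].
  by apply: ArcNext; rewrite //= index_neq_last // (ltn_trans lt_xi).
case: xC nx => [[-> ->]//|[xr anc_x] _]; apply: ArcUp => //=.
apply: contraNneq vR => <-; apply: ancestor_cut anc_x.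
by rewrite R_index ?mem_nth_leaf // index_nth_leaf.
Qed.

Lemma leaf_cycle_next i j : j < t -> ((nth r L j, next L (nth r L j)) \in leaf_cycle i) = (j < i).
Proof.
move=> lt_jt; have jL := mem_nth_leaf lt_jt; have ij := index_nth_leaf lt_jt.
apply/imsetP/idP => [[x xC [xE]]|lt_ji]; last first.
  exists (nth r L j); last by rewrite /succ_cycle jL ij lt_ji.
  by apply/cycle_vertsP; left; rewrite jL ij.
move/cycle_vertsP: xC; rewrite -xE /succ_cycle jL ij; case: ifP => //= nij.
case=> [[]//|[jr _]] nE.
by have := next_neq_par jL jr; rewrite nE eqxx.
Qed.

Lemma leaf_cycle_inj : injective (fun i : 'I_t => leaf_cycle i).
Proof.
move=> i j Eij; apply/val_inj/eqP; rewrite /= eqn_leq.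
have := leaf_cycle_next i (ltn_ord j); have := leaf_cycle_next j (ltn_ord i).
rewrite -{1}Eij leaf_cycle_next // ltnn => /esym/negbT; rewrite -leqNgt => ->.
by rewrite Eij leaf_cycle_next // ltnn => /esym/negbT; rewrite -leqNgt => ->.
Qed.

(** Take for [i] the first leaf index whose rim arc is missing from [S]. Balance forces the tree
    arcs from that leaf up to the root, and tracing any tree arc of [S] backwards ends at that
    leaf. *)
Lemma eulerian_is_leaf_cycle S : eulerian_sub D S -> exists i : 'I_t, S = leaf_cycle i.
Proof.
move=> eS; pose y i := nth r L i; pose P i := (y i, next L (y i)) \in S.
have outS x u : (x, u) \in S ->
    [/\ x != r, x \in R & u = par x] \/ [/\ x \in L, (index x L).+1 < t & u = next L x].
  by move=> /(eulerian_oddP eS)[] z z1 z2; [left|right].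
have nextS x : x \in L -> (x, next L x) \in S -> (index x L).+1 < t.
  move=> xL /outS[[xr _ nE]|[]//].
  by have := next_neq_par xL xr; rewrite nE eqxx.
have upS x : x != r -> (x, par x) \in S -> x \in R.
  move=> xr /outS[[]//|[xL _ pE]].
  by have := next_neq_par xL xr; rewrite pE eqxx.
(* The rim arc out of the last leaf of [R] would leave [R]. *)
have nPt : ~~ P t.-1.
  have lt_t1 : t.-1 < t by rewrite prednK.
  apply/negP => /(nextS _ (mem_nth_leaf lt_t1)).
  by rewrite index_nth_leaf // prednK // ltnn.
case: (ex_minnP (ex_intro (fun i => ~~ P i) _ nPt)) => i nPi i_min.
have lt_it : i < t by apply: leq_ltn_trans (i_min _ nPt) _; rewrite prednK.
have P_lt j : j < i -> P j by apply: contraTT => /i_min; rewrite -leqNgt.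
have y_next j : j.+1 < t -> next L (y j) = y j.+1.
  move=> lt_jt; have jL := mem_nth_leaf (ltnW lt_jt).
  have := index_nextL jL; rewrite index_nth_leaf 1?ltnW // => idx.
  rewrite -(nth_index r (mem_nextL jL)) idx // index_neq_last // index_nth_leaf //; exact: ltnW.
have in_leaf x u : x \in L -> x != r -> (u, x) \in S -> P (index x L).-1 /\ 0 < index x L.
  move=> xL xr uxS; have [xE u_in] := eulerian_leaf_in eS xL xr uxS.
  have := nextS u u_in; rewrite -xE uxS => /(_ isT) lt_ut.
  have -> : index x L = (index u L).+1.
    by rewrite xE index_nextL // index_neq_last // ltnW.
  by rewrite /P /y /= nth_index // -xE uxS.
(* A leaf other than the root is entered only from its predecessor, so the rim arcs in [S] form an
   initial stretch. *)
have P_down j k : j <= k -> k < t -> P k -> P j.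
  elim: k => [|k IHk]; first by rewrite leqn0 => /eqP->.
  rewrite leq_eqVlt => /predU1P[->//|le_jk] lt_kt Pk; apply: IHk => //; first exact: ltnW.
  have kL := mem_nth_leaf lt_kt; have idx := index_nth_leaf lt_kt.
  have [u uS] := eulerian_out_in eS Pk.
  by have [] := in_leaf _ _ kL (leaf_neq_root kL _) uS; rewrite idx.
have up_leaf x : x \in L -> (x, par x) \in S -> x = y i.
  move=> xL xS; have [u uS] := eulerian_out_in eS xS.
  have xr : x != r.
    apply: contraTneq xS => ->; rewrite (par_root rT); apply/negP => /outS[[]|[_ _ rE]].
      by rewrite eqxx.
    by have := next_neq rL; rewrite -rE eqxx.
  have xR := upS x xr xS.
  have [Px x_gt0] := in_leaf _ _ xL xr uS.
  have nPx := eulerian_leaf_up eS xL xS xr.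
  have lt_xt : index x L < t by rewrite -R_index.
  rewrite -(nth_index r xL); congr (nth r L _); apply/eqP; rewrite eqn_leq; apply/andP; split.
    rewrite leqNgt; apply: contra nPi => lt_ix; apply: P_down Px; last exact: leq_ltn_trans (leq_pred _) lt_xt.
    by rewrite -ltnS prednK.
  by apply: i_min; rewrite /P /y nth_index.
exists (Ordinal lt_it); rewrite /=.
have up_anc x : x != r -> ancestor par dep x (y i) -> (x, par x) \in S.
  move=> + /(ancestorP rT)[k xE]; rewrite xE {x xE}; elim: k => [|k IHk] /= kr.
    have i_gt0 : 0 < i by rewrite lt0n; apply: contraNneq kr => i0; rewrite /y i0 -{1}index_r nth_index.
    have := P_lt i.-1; rewrite prednK // leqnn => /(_ isT); rewrite /P y_next ?prednK // => yS.
    have [u uS] := eulerian_in_out eS yS.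
    by case: (outS _ _ uS) => [[_ _ <-]|[_ _ uE]] //; move: nPi; rewrite /P -uE uS.
  have [zr|zr] := eqVneq (iter k par (y i)) r; first by rewrite zr (par_root rT) eqxx in kr.
  have [u uS] := eulerian_in_out eS (IHk zr).
  by case: (outS _ _ uS) => [[_ _ <-]|[/(leaf_par_root zr) pE]] //; rewrite pE eqxx in kr.
(* Induction from the deepest vertices: an arc of [S] entering an inner [x] comes from a child, and
   the only leaf that climbs is [y i]. *)
have anc_up n x : (\max_y dep y) - dep x < n -> x != r -> (x, par x) \in S ->
    ancestor par dep x (y i).
  elim: n x => // n IHn x lt_n xr xS; have [xL|xL] := boolP (x \in L).
    by rewrite (up_leaf x xL xS) (ancestorxx rT).
  have [u uS] := eulerian_out_in eS xS.
  case: (outS _ _ uS) => [[ur _ xE]|[/mem_nextL + _ uE]]; last by rewrite -uE (negbTE xL).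
  rewrite xE (ancestor_par rT) // IHn -?xE //.
  have := leq_bigmax (F := dep) u; have := dep_par rT ur; rewrite -xE => -> lt_u.
  by rewrite ltnS in lt_n; apply: leq_trans lt_n; rewrite ltn_sub2l // (leq_ltn_trans _ lt_u).
apply/setP => -[x u]; apply/idP/imsetP => [xuS|[z zC [-> ->]]].
  exists x.
    apply/cycle_vertsP; case: (outS _ _ xuS) => [[xr _ uE]|[xL _ uE]]; last left.
      by right; split=> //; apply: (anc_up _ x (ltnSn _)) => //; rewrite -uE.
    split=> //; rewrite ltnNge; apply: contra nPi => le_ix.
    apply: P_down le_ix _ _; first by rewrite ltnW // nextS // -uE.
    by rewrite /P /y nth_index // -uE.
  congr (_, _); rewrite /succ_cycle; case: (outS _ _ xuS) => [[xr _ uE]|[xL _ uE]].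
    case: ifP => // /andP[xL]; rewrite uE in xuS.
    by rewrite (up_leaf x xL xuS) index_nth_leaf // ltnn.
  rewrite xL ifT // ltnNge; apply: contra nPi => le_ix.
  apply: P_down le_ix _ _; first by rewrite ltnW // nextS // -uE.
  by rewrite /P /y nth_index // -uE.
move/cycle_vertsP: zC; rewrite /succ_cycle; case: ifP => [/andP[zL lt_zi] _|nz].
  by have := P_lt _ lt_zi; rewrite /P /y nth_index.
by case=> [[zL lt_zi]|[zr /(up_anc _ zr)]//]; rewrite zL lt_zi in nz.
Qed.

(** There are exactly [t] Eulerian subdigraphs, and an odd total does not split into two equal
    counts. *)
Lemma AT_good3_odd : odd t -> AT_good adj 3.
Proof.
move=> odd_t; exists D; split; [exact: halin_arcs_orientation|exact: outdeg_odd|].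
have cE : #|[set S | eulerian_sub D S]| = t.
  rewrite -[t]card_ord -(card_imset predT leaf_cycle_inj); apply: eq_card => S.
  rewrite inE; apply/idP/imsetP => [/eulerian_is_leaf_cycle[i ->]|[i _ ->]]; first by exists i.
  exact: eulerian_leaf_cycle.
move=> E; move: odd_t; rewrite -cE -(cardsID [set S : {set V * V} | odd #|S|]).
have -> : [set S | eulerian_sub D S] :&: [set S : {set V * V} | odd #|S|]
    = [set S | eulerian_sub D S && odd #|S|] by apply/setP => S; rewrite !inE.
have -> : [set S | eulerian_sub D S] :\: [set S : {set V * V} | odd #|S|]
    = [set S | eulerian_sub D S && ~~ odd #|S|] by apply/setP => S; rewrite !inE andbC.
by rewrite -/(n_odd_eul D) -/(n_even_eul D) E addnn odd_double.
Qed.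

End OddCase.

End HalinOrientation.

(** * From the plane drawing to the Alon-Tarsi number *)

Section Halin.
Variables (V : finType) (adj T : rel V) (rho : V -> V -> V).
Hypothesis halin : halin_structure adj T rho.

Let treeT : is_tree T. Proof. by case: halin. Qed.
Let rotT : rotation_system T rho. Proof. by case: halin. Qed.
Let deg2 : forall v, deg T v <> 2. Proof. by case: halin. Qed.
Let deg3 : exists v, 3 <= deg T v. Proof. by case: halin. Qed.
Let symT : symmetric T. Proof. by case: treeT. Qed.
Let leaf_nadj := leaf_not_adj treeT deg3.

Let L d := leaf_seq T rho d.

Section LeafSeqFacts.
Variables (d : V * V).
Hypothesis dT : T d.1 d.2.

Lemma halin_leaf_seq_uniq : uniq (L d). Proof. exact: leaf_seq_uniq. Qed.

Lemma halin_mem_leaf_seq x : (x \in L d) = leaf T x. Proof. exact: mem_leaf_seq. Qed.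

Lemma size_leaf_seq : size (L d) = #|[set x | leaf T x]|.
Proof.
rewrite -(card_uniqP halin_leaf_seq_uniq); apply: eq_card => x.
by rewrite inE halin_mem_leaf_seq.
Qed.

Lemma size_leaf_seq_gt2 : 2 < size (L d).
Proof.
rewrite size_leaf_seq; apply: leq_trans (many_leaves treeT deg2 deg3).
by rewrite addn2 !ltnS inner_gt0.
Qed.

Lemma halin_adjE u v : adj u v <->
  (T u v \/ (leaf T u /\ v = next (L d) u) \/ (leaf T v /\ u = next (L d) v)).
Proof.
have [_ _ _ _ ->] := halin; have := next_leafP treeT rotT dT u v.
by have := next_leafP treeT rotT dT v u; tauto.
Qed.

End LeafSeqFacts.

Lemma card_inner_leaves : #|inner_vertices T| + #|[set x | leaf T x]| = #|V|.
Proof.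
rewrite addnC -(cardsC [set x | leaf T x]); congr (_ + _).
by apply: eq_card => x; rewrite !inE.
Qed.

Lemma halin_dart : exists d, T d.1 d.2.
Proof.
have [z z3] := deg3; have /card_gt0P[x] := ltn_trans (isT : 0 < 2) z3.
by rewrite inE => zx; exists (z, x).
Qed.

Lemma halin_AT_lower j : j < 3 -> ~ AT_good adj j.
Proof.
move=> lt_j3; have [d dT] := halin_dart.
exact: (AT_lower (halin_leaf_seq_uniq dT) (halin_mem_leaf_seq dT) (size_leaf_seq_gt2 dT)
  leaf_nadj (halin_adjE dT) treeT lt_j3).
Qed.

Lemma exists_inner : exists r, ~~ leaf T r.
Proof. by have /card_gt0P[r] := inner_gt0 deg3; rewrite inE => lr; exists r. Qed.

Lemma halin_AT_good4 : AT_good adj 4.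
Proof.
have [d dT] := halin_dart; have [r lr] := exists_inner.
have [par [dep rT]] := tree_rooted r treeT.
exact: (AT_good4 (halin_leaf_seq_uniq dT) (halin_mem_leaf_seq dT) (size_leaf_seq_gt2 dT)
  leaf_nadj rT symT (halin_adjE dT) lr).
Qed.

Lemma halin_AT_good3_even : ~~ odd #|[set x | leaf T x]| -> AT_good adj 3.
Proof.
have [d dT] := halin_dart; have [r lr] := exists_inner.
have [par [dep rT]] := tree_rooted r treeT.
rewrite -(size_leaf_seq dT) => nL.
exact: (AT_good3_even (halin_leaf_seq_uniq dT) (halin_mem_leaf_seq dT) (size_leaf_seq_gt2 dT)
  leaf_nadj rT symT (halin_adjE dT) lr nL).
Qed.

(** Listing the leaves from the dart [(v, w)] puts those of [R] first; the head of the list becomes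
    the root and [t] is their number. *)
Lemma halin_AT_good3_cut v w (R : {set V}) : T v w -> ~~ leaf T w ->
    w \in R -> v \notin R ->
    (forall x y, x \notin R -> y \in R -> T x y -> x = v /\ y = w) ->
    odd #|[set x | leaf T x] :&: R| -> AT_good adj 3.
Proof.
move=> Tvw lw wR vR cutR odd_R; have dT : T (v, w).1 (v, w).2 by [].
have [LR [LG [LE LR_R LG_R]]] := leaf_seq_cut treeT rotT Tvw wR vR cutR.
have uL := halin_leaf_seq_uniq dT; rewrite -/(L _) in LE.
have mem_LR x : x \in L (v, w) -> (x \in LR) = (x \in R).
  rewrite LE mem_cat => /orP[xL|xL]; first by rewrite xL LR_R.
  by rewrite (negbTE (LG_R x xL)); apply: contraNF (LG_R x xL) => /LR_R.
have LR_sub x : x \in LR -> x \in L (v, w) by move=> xL; rewrite LE mem_cat xL.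
have odd_LR : odd (size LR).
  move: uL; rewrite LE cat_uniq => /andP[/card_uniqP <- _].
  suff -> : #|LR| = #|[set x | leaf T x] :&: R| by [].
  apply: eq_card => x; rewrite !inE -(halin_mem_leaf_seq dT).
  by apply/idP/andP => [xL|[xL]]; [rewrite -mem_LR ?LR_sub|rewrite mem_LR].
case ELR: LR odd_LR => [//|r LR'] odd_LR.
have rL : r \in L (v, w) by rewrite LR_sub // ELR mem_head.
have [par [dep rT]] := tree_rooted r treeT.
apply: (AT_good3_odd uL (halin_mem_leaf_seq dT) (size_leaf_seq_gt2 dT) leaf_nadj rT symT
  (halin_adjE dT) lw wR vR cutR rL _ _ _ _ odd_LR) => //.
- by rewrite LE ELR /= eqxx.
- move=> x xL; rewrite -mem_LR // LE ELR index_cat -ELR.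
  by case: ifP => xR; rewrite ?index_mem // ltnNge leq_addr.
have [x lx xR] := leaf_seq_cut_nonempty treeT Tvw wR vR cutR.
rewrite LE size_cat ELR -addn1 leq_add2l; case: LG LE {LG_R} => // LE.
by move: xR; rewrite -mem_LR ?halin_mem_leaf_seq // -[LR]cats0 -LE halin_mem_leaf_seq // lx.
Qed.

Lemma halin_AT_good3_odd : odd #|[set x | leaf T x]| -> ~~ is_wheel T -> AT_good adj 3.
Proof.
move=> odd_L /(inner_edge treeT deg3)[v [w [Tvw lv lw]]].
have [R [wR vR cutR]] := tree_cut treeT Tvw.
(* Both ends of the edge are inner, so either side can serve as [R]; the total being odd, one side
   has an odd number of leaves. *)
move: odd_L; rewrite -(cardsID R) oddD; case: (boolP (odd #|_ :&: R|)) => [+ _|_ /= odd_R].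
  exact: halin_AT_good3_cut Tvw lw wR vR cutR.
have Twv : T w v by rewrite symT.
have vR' : v \in ~: R by rewrite in_setC.
have wR' : w \notin ~: R by rewrite in_setC negbK.
have cutR' x y : x \notin ~: R -> y \in ~: R -> T x y -> x = w /\ y = v.
  rewrite !in_setC negbK symT => xR yR Tyx.
  by have [-> ->] := cutR y x yR xR Tyx.
apply: (halin_AT_good3_cut Twv lv vR' wR' cutR').
by rewrite -setDE.
Qed.

(* The successor map swaps the two colours on the rim. *)
Lemma even_wheel_not_AT3 : is_wheel T -> ~~ odd #|V| -> ~ AT_good adj 3.
Proof.
move=> /cards1P[h innerE] evenV /(AT_good_colouring (isT : 0 < 3))[c cP].
have [d dT] := halin_dart; have uL := halin_leaf_seq_uniq dT.
have memL := halin_mem_leaf_seq dT; have adjE := halin_adjE dT.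
pose A := [set x | leaf T x].
have oddA : odd #|A| by move: evenV; rewrite -card_inner_leaves innerE cards1 /= negbK.
have hub x : x \in A -> c x != c h.
  rewrite inE => lx; have [y xy] := leaf_adj lx.
  have yh : y = h.
    apply/set1P; rewrite -innerE inE; apply/negP => ly.
    by have := leaf_nadj lx ly; rewrite xy.
  by apply: cP; apply/adjE; left; rewrite -yh.
have nextA x : x \in A -> next (L d) x \in A by rewrite !inE -!memL mem_next.
have c_next x : x \in A -> c (next (L d) x) != c x.
  by rewrite inE eq_sym => lx; apply: cP; apply/adjE; right; left.
(* With the hub colour [e] excluded two colours remain, so those different from [f] agree. *)
have three (a b e f : 'I_3) : a != e -> b != e -> f != e -> a != f -> b != f -> a = b.
  rewrite -!(inj_eq val_inj) /= => *; apply: val_inj => /=.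
  by move: (ltn_ord a) (ltn_ord b) (ltn_ord e) (ltn_ord f); lia.
have [x0 x0A] : exists x, x \in A by apply/card_gt0P; case: #|A| oddA.
pose B := A :&: [set x | c x == c x0].
(* The successor map injects each of the two classes of leaves into the other; equal sizes would
   make the rim even. *)
have le1 : #|B| <= #|A :\: [set x | c x == c x0]|.
  rewrite -(card_imset B (can_inj (prev_next uL))); apply/subset_leq_card/subsetP => _ /imsetP[x + ->].
  by rewrite in_setI in_setD !in_set -!(in_set (leaf T)) => /andP[xA /eqP <-]; rewrite nextA ?c_next.
have le2 : #|A :\: [set x | c x == c x0]| <= #|B|.
  rewrite -(card_imset (A :\: _) (can_inj (prev_next uL))); apply/subset_leq_card/subsetP => _ /imsetP[x + ->].
  rewrite in_setI in_setD !in_set -!(in_set (leaf T)) => /andP[xx0 xA]; rewrite nextA //=.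
  by apply/eqP/(three _ _ (c h) (c x)); rewrite ?hub ?nextA ?c_next // eq_sym.
move: oddA; rewrite -(cardsID [set x | c x == c x0]) -/B.
have -> : #|A :\: [set x | c x == c x0]| = #|B| by apply/eqP; rewrite eqn_leq le1 le2.
by rewrite addnn odd_double.
Qed.

End Halin.

Theorem mainTheorem1 (V : finType) (adj : rel V) (T : rel V) (rho : V -> V -> V) :
  halin_structure adj T rho ->
  AT_number adj (if is_wheel T && ~~ odd #|V| then 4 else 3).
Proof.
move=> halin; case: ifP => [/andP[wheel evenV]|not_even_wheel].
  split; first exact: halin_AT_good4 halin.
  by move=> j lt_j4 /(AT_goodW (lt_j4 : j <= 3)); apply: even_wheel_not_AT3 halin wheel evenV.
split; last by move=> j; apply: (halin_AT_lower halin).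
have [odd_L|] := boolP (odd #|[set x | leaf T x]|); last exact: halin_AT_good3_even halin.
(* A wheel with an odd number of leaves would have even order, the excluded case. *)
apply: (halin_AT_good3_odd halin odd_L); apply/negP => wheel; move: not_even_wheel.
by rewrite wheel -(card_inner_leaves T) (eqP wheel) /= odd_L.
Qed.
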